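(* Let $\mathbf{L}$ be one of the logics described in the context. The weakening rules $LW$: from $\Gamma\Rightarrow\Delta$ infer $\Gamma',\Gamma\Rightarrow\Delta$, and $RW$: from $\Gamma\Rightarrow\Delta$ infer $\Gamma\Rightarrow\Delta,\Delta'$ (for arbitrary multisets $\Gamma'$, $\Delta'$ of the appropriate kinds) are height-preserving admissible in $\mathbf{G3Q\lambda.L}$: if the premiss is derivable with height at most $n$, so is the conclusion.
   Context: Language $\mathcal{L}^\lambda$: fix a signature of $n$-ary predicate letters and an infinite set of variables $x,y,z,\dots$. Terms and formulas are defined simultaneously: terms $t::=x\mid \iota xA$ (definite descriptions), formulas $A::=Px_1\dots x_n\mid x_1=x_2\mid\bot\mid A\wedge A\mid A\vee A\mid A\supset A\mid\forall xA\mid\exists xA\mid\Box A\mid\Diamond A\mid \lambda xA.t$. $\iota x$ binds $x$ in $A$; in $\lambda xA.t$ the occurrences of $x$ in $A$ are bound by $\lambda x$ (the displayed $t$ is not in its scope). $A[y/x]$ replaces free occurrences of $x$ by $y$, with $y$ free for $x$. Atomic formulas are $Px_1\dots x_n$ and $x_1=x_2$. Labelled sequents. Labels $w,v,u,\dots$ form a separate set. Expressions: labelled formulas $w:A$, domain atoms $x\in w$, relational atoms $w\mathscr{R}v$, denotation formulas $D(t,x,w)$ ($t$ a term, $x$ a variable). A sequent $\Gamma\Rightarrow\Delta$ has $\Gamma$ a multiset of labelled formulas, denotation formulas, domain atoms and relational atoms, and $\Delta$ a multiset of labelled formulas and denotation formulas. Substitutions $[y/x]$, $[w/v]$ extend componentwise.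 ''Fresh'' means not occurring in the conclusion of the rule. Calculus $\mathbf{G3Q\lambda.K}$. Initial sequents: $w:p,\Gamma\Rightarrow\Delta,w:p$ ($p$ atomic); $D(y,x,w),\Gamma\Rightarrow\Delta,D(y,x,w)$ ($y$ a variable); $w:\bot,\Gamma\Rightarrow\Delta$. Propositional rules (at one label $w$): $L\wedge$: from $w:A,w:B,\Gamma\Rightarrow\Delta$ infer $w:A\wedge B,\Gamma\Rightarrow\Delta$; $R\wedge$: from $\Gamma\Rightarrow\Delta,w:A$ and $\Gamma\Rightarrow\Delta,w:B$ infer $\Gamma\Rightarrow\Delta,w:A\wedge B$; $L\vee$: from $w:A,\Gamma\Rightarrow\Delta$ and $w:B,\Gamma\Rightarrow\Delta$ infer $w:A\vee B,\Gamma\Rightarrow\Delta$; $R\vee$: from $\Gamma\Rightarrow\Delta,w:A,w:B$ infer $\Gamma\Rightarrow\Delta,w:A\vee B$; $L\supset$: from $\Gamma\Rightarrow\Delta,w:A$ and $w:B,\Gamma\Rightarrow\Delta$ infer $w:A\supset B,\Gamma\Rightarrow\Delta$; $R\supset$: from $w:A,\Gamma\Rightarrow\Delta,w:B$ infer $\Gamma\Rightarrow\Delta,w:A\supset B$. Quantifiers: $L\forall$: from $w:A[y/x],y\in w,w:\forall xA,\Gamma\Rightarrow\Delta$ infer $y\in w,w:\forall xA,\Gamma\Rightarrow\Delta$; $R\forall$ ($z$ fresh): from $z\in w,\Gamma\Rightarrow\Delta,w:A[z/x]$ infer $\Gamma\Rightarrow\Delta,w:\forall xA$; $L\exists$ ($z$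 fresh): from $z\in w,w:A[z/x],\Gamma\Rightarrow\Delta$ infer $w:\exists xA,\Gamma\Rightarrow\Delta$; $R\exists$: from $y\in w,\Gamma\Rightarrow\Delta,w:\exists xA,w:A[y/x]$ infer $y\in w,\Gamma\Rightarrow\Delta,w:\exists xA$. Modalities: $L\Box$: from $v:A,w\mathscr{R}v,w:\Box A,\Gamma\Rightarrow\Delta$ infer $w\mathscr{R}v,w:\Box A,\Gamma\Rightarrow\Delta$; $R\Box$ ($u$ fresh): from $w\mathscr{R}u,\Gamma\Rightarrow\Delta,u:A$ infer $\Gamma\Rightarrow\Delta,w:\Box A$; $L\Diamond$ ($u$ fresh): from $w\mathscr{R}u,u:A,\Gamma\Rightarrow\Delta$ infer $w:\Diamond A,\Gamma\Rightarrow\Delta$; $R\Diamond$: from $w\mathscr{R}v,\Gamma\Rightarrow\Delta,w:\Diamond A,v:A$ infer $w\mathscr{R}v,\Gamma\Rightarrow\Delta,w:\Diamond A$. Identity: $Ref_=$: from $w:x=x,\Gamma\Rightarrow\Delta$ infer $\Gamma\Rightarrow\Delta$; $RigVar$: from $v:y=z,w:y=z,\Gamma\Rightarrow\Delta$ infer $w:y=z,\Gamma\Rightarrow\Delta$; $Repl$: from $E[z/x],E[y/x],w:y=z,\Gamma\Rightarrow\Delta$ infer $E[y/x],w:y=z,\Gamma\Rightarrow\Delta$, where $E$ is a denotation formula with variable first argument and label $w$, a domain atom $x'\in w$, or a labelled atomic formula $w:p$. $\lambda$: $L\lambda$ ($z$ fresh): from $D(t,z,w),w:B[z/x],\Gamma\Rightarrow\Delta$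 infer $w:\lambda xB.t,\Gamma\Rightarrow\Delta$; $R\lambda$: from $\Gamma\Rightarrow\Delta,w:\lambda xB.t,D(t,y,w)$ and $\Gamma\Rightarrow\Delta,w:\lambda xB.t,w:B[y/x]$ infer $\Gamma\Rightarrow\Delta,w:\lambda xB.t$. Denotation: $LD_1$: from $w:A[x_2/x_1],D(\iota x_1A,x_2,w),\Gamma\Rightarrow\Delta$ infer $D(\iota x_1A,x_2,w),\Gamma\Rightarrow\Delta$; $LD_2$: from $D(\iota x_1A,x_2,w),\Gamma\Rightarrow\Delta,w:A[y/x_1]$ and $w:x_2=y,D(\iota x_1A,x_2,w),\Gamma\Rightarrow\Delta$ infer $D(\iota x_1A,x_2,w),\Gamma\Rightarrow\Delta$; $RD$ ($z$ fresh): from $\Gamma\Rightarrow\Delta,w:A[x_2/x_1]$ and $w:A[z/x_1],\Gamma\Rightarrow\Delta,w:x_2=z$ infer $\Gamma\Rightarrow\Delta,D(\iota x_1A,x_2,w)$; $DenVar$: from $D(x,x,w),\Gamma\Rightarrow\Delta$ infer $\Gamma\Rightarrow\Delta$; $DenId$: from $w:y=x,D(y,x,w),\Gamma\Rightarrow\Delta$ infer $D(y,x,w),\Gamma\Rightarrow\Delta$ ($x,y$ variables). Non-logical rules: $Ref_\mathcal{W}$: from $w\mathscr{R}w,\Gamma\Rightarrow\Delta$ infer $\Gamma\Rightarrow\Delta$; $Ser$ ($u$ fresh): from $w\mathscr{R}u,\Gamma\Rightarrow\Delta$ infer $\Gamma\Rightarrow\Delta$; $Trans$: from $w\mathscr{R}u,w\mathscr{R}v,v\mathscr{R}u,\Gamma\Rightarrow\Delta$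 infer $w\mathscr{R}v,v\mathscr{R}u,\Gamma\Rightarrow\Delta$; $Eucl$: from $v\mathscr{R}u,w\mathscr{R}v,w\mathscr{R}u,\Gamma\Rightarrow\Delta$ infer $w\mathscr{R}v,w\mathscr{R}u,\Gamma\Rightarrow\Delta$, always together with $Eucl^c$: from $v\mathscr{R}v,w\mathscr{R}v,\Gamma\Rightarrow\Delta$ infer $w\mathscr{R}v,\Gamma\Rightarrow\Delta$; $Incr$: from $x\in v,x\in w,w\mathscr{R}v,\Gamma\Rightarrow\Delta$ infer $x\in w,w\mathscr{R}v,\Gamma\Rightarrow\Delta$; $Decr$: from $x\in w,x\in v,w\mathscr{R}v,\Gamma\Rightarrow\Delta$ infer $x\in v,w\mathscr{R}v,\Gamma\Rightarrow\Delta$; $Cons$: from $x\in w,\Gamma\Rightarrow\Delta$ infer $\Gamma\Rightarrow\Delta$. For any set $N$ of these non-logical rules, $\mathbf{G3Q\lambda.L}=\mathbf{G3Q\lambda.K}+N$. Derivations: trees of (pure: no variable both free and bound) sequents with initial sequents at the leaves, built by the rules; the height of a derivation is the number of nodes of its longest branch. $\Gamma\Rightarrow\Delta$ is derivable with height $n$ if it or an alphabetic variant has a derivation of height at most $n$. *)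

(* Defs.v *)
(* MathComp, with Stdlib's [Permutation] and [Forall2] on lists. *)
From Stdlib Require List Permutation.
From mathcomp Require Export all_boot.
From mathcomp Require Export classical_sets cardinality.

Set Implicit Arguments.
Unset Strict Implicit.
Unset Printing Implicit Defensive.

(** * The language *)

Section Syntax.

(* [Sig] is the type of predicate letters and [ar] gives their arities;
   [V] is the type of variables. *)
Variables (Sig : Type) (ar : Sig -> nat) (V : eqType).

(* [Lam x A t] is lambda x A . t *)
Inductive term : Type :=
| Var of V
| Iota of V & form
with form : Type :=
| Pred (p : Sig) of (ar p).-tuple V
| Eq of V & V
| Bot
| And of form & form
| Or of form & form
| Imp of form & form
| All of V & form
| Ex of V & form
| Box of form
| Dia of form
| Lam of V & form & term.

Definition atomic (A : form) : bool :=
  match A with Pred _ _ | Eq _ _ => true | _ => false end.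

Fixpoint fvt (t : term) : seq V :=
  match t with
  | Var x => [:: x]
  | Iota x A => [seq y <- fvf A | y != x]
  end
with fvf (A : form) : seq V :=
  match A with
  | Pred p xs => xs
  | Eq x y => [:: x; y]
  | Bot => [::]
  | And A B | Or A B | Imp A B => fvf A ++ fvf B
  | All x A | Ex x A => [seq y <- fvf A | y != x]
  | Box A | Dia A => fvf A
  | Lam x A t => [seq y <- fvf A | y != x] ++ fvt t
  end.

(* The variable displayed next to a binder counts as bound, even when the
   binder is vacuous; hence every variable occurring in an expression is
   among its free or among its bound variables. *)
Fixpoint bvt (t : term) : seq V :=
  match t with
  | Var x => [::]
  | Iota x A => x :: bvf A
  end
with bvf (A : form) : seq V :=
  match A with
  | Pred _ _ | Eq _ _ | Bot => [::]
  | And A B | Or A B | Imp A B => bvf A ++ bvf B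
  | All x A | Ex x A => x :: bvf A
  | Box A | Dia A => bvf A
  | Lam x A t => x :: bvf A ++ bvt t
  end.

Definition substv (y x z : V) : V := if z == x then y else z.

(* [substf y x A] is A[y/x]: it replaces the free occurrences of [x] by [y],
   without renaming; it is only used when [y] is free for [x] in [A]. *)
Fixpoint substt (y x : V) (t : term) : term :=
  match t with
  | Var z => Var (substv y x z)
  | Iota z A => Iota z (if z == x then A else substf y x A)
  end
with substf (y x : V) (A : form) : form :=
  match A with
  | Pred p xs => Pred (map_tuple (substv y x) xs)
  | Eq z1 z2 => Eq (substv y x z1) (substv y x z2)
  | Bot => Bot
  | And A B => And (substf y x A) (substf y x B)
  | Or A B => Or (substf y x A) (substf y x B)
  | Imp A B => Imp (substf y x A) (substf y x B)
  | All z A => All z (if z == x then A else substf y x A)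
  | Ex z A => Ex z (if z == x then A else substf y x A)
  | Box A => Box (substf y x A)
  | Dia A => Dia (substf y x A)
  | Lam z A t =>
      Lam z (if z == x then A else substf y x A) (substt y x t)
  end.

(* [free_forf y x A]: [y] is free for [x] in [A], i.e. no free occurrence of
   [x] in [A] lies in the scope of a binder of [y]. *)
Fixpoint free_fort (y x : V) (t : term) : bool :=
  match t with
  | Var _ => true
  | Iota z A =>
      [|| z == x, x \notin fvf A | (z != y) && free_forf y x A]
  end
with free_forf (y x : V) (A : form) : bool :=
  match A with
  | Pred _ _ | Eq _ _ | Bot => true
  | And A B | Or A B | Imp A B => free_forf y x A && free_forf y x B
  | All z A | Ex z A =>
      [|| z == x, x \notin fvf A | (z != y) && free_forf y x A]
  | Box A | Dia A => free_forf y x A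
  | Lam z A t =>
      [|| z == x, x \notin fvf A | (z != y) && free_forf y x A]
      && free_fort y x t
  end.

(* Alphabetic variants (equality up to renaming of bound variables).  The list
   [r] records the pairs of corresponding binders met so far, innermost first;
   two variable occurrences correspond to each other when they are bound by
   corresponding binders, or are both free and equal. *)
Fixpoint alphav (r : seq (V * V)) (x y : V) : bool :=
  if r is (a, b) :: r' then
    if (x == a) || (y == b) then (x == a) && (y == b) else alphav r' x y
  else x == y.

Fixpoint alphat (r : seq (V * V)) (t t' : term) : Prop :=
  match t, t' with
  | Var x, Var y => alphav r x y
  | Iota x A, Iota y B => alphaf ((x, y) :: r) A B
  | _, _ => False
  end
with alphaf (r : seq (V * V)) (A A' : form) : Prop :=
  match A, A' with
  | Pred p xs, Pred q ys => p = q /\ all2 (alphav r) xs ys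
  | Eq x1 x2, Eq y1 y2 => alphav r x1 y1 /\ alphav r x2 y2
  | Bot, Bot => True
  | And A B, And A' B' | Or A B, Or A' B' | Imp A B, Imp A' B' =>
      alphaf r A A' /\ alphaf r B B'
  | All x A, All y B | Ex x A, Ex y B => alphaf ((x, y) :: r) A B
  | Box A, Box B | Dia A, Dia B => alphaf r A B
  | Lam x A t, Lam y B t' => alphaf ((x, y) :: r) A B /\ alphat r t t'
  | _, _ => False
  end.

End Syntax.

Arguments Var {Sig ar V} _.
Arguments Iota {Sig ar V} _ _.
Arguments Pred {Sig ar V} _ _.
Arguments Eq {Sig ar V} _ _.
Arguments Bot {Sig ar V}.

(** * Labelled sequents *)

Section Sequents.

Variables (Sig : Type) (ar : Sig -> nat) (V L : eqType).

(* Expressions allowed on both sides of a sequent: w : A and D(t,x,w). *)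
Inductive sexp : Type :=
| Form of L & form ar V
| Den of term ar V & V & L.

(* Expressions allowed on the left: in addition, x \in w and w R v. *)
Inductive aexp : Type :=
| Both of sexp
| Dom of V & L
| Rel of L & L.

(* The two lists stand for multisets: see [meq] below. *)
Definition sequent : Type := (seq aexp * seq sexp)%type.

Definition meq (S S' : sequent) : Prop :=
  Permutation.Permutation S.1 S'.1 /\ Permutation.Permutation S.2 S'.2.

Definition fvs (e : sexp) : seq V :=
  match e with Form _ A => fvf A | Den t x _ => x :: fvt t end.
Definition bvs (e : sexp) : seq V :=
  match e with Form _ A => bvf A | Den t _ _ => bvt t end.
Definition labs (e : sexp) : seq L :=
  match e with Form w _ => [:: w] | Den _ _ w => [:: w] end.

Definition fva (e : aexp) : seq V :=
  match e with Both e => fvs e | Dom x _ => [:: x] | Rel _ _ => [::] end.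
Definition bva (e : aexp) : seq V :=
  match e with Both e => bvs e | Dom _ _ | Rel _ _ => [::] end.
Definition laba (e : aexp) : seq L :=
  match e with Both e => labs e | Dom _ w => [:: w] | Rel w v => [:: w; v] end.

Definition fvq (S : sequent) : seq V :=
  flatten (map fva S.1) ++ flatten (map fvs S.2).
Definition bvq (S : sequent) : seq V :=
  flatten (map bva S.1) ++ flatten (map bvs S.2).
Definition labq (S : sequent) : seq L :=
  flatten (map laba S.1) ++ flatten (map labs S.2).

(* No variable has both free and bound occurrences in the sequent. *)
Definition pure (S : sequent) : Prop :=
  forall x, ~~ ((x \in fvq S) && (x \in bvq S)).

Definition fresh (z : V) (S : sequent) : bool :=
  (z \notin fvq S) && (z \notin bvq S).
Definition freshl (u : L) (S : sequent) : bool := u \notin labq S.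

Definition substs (y x : V) (e : sexp) : sexp :=
  match e with
  | Form w A => Form w (substf y x A)
  | Den t z w => Den (substt y x t) (substv y x z) w
  end.
Definition substa (y x : V) (e : aexp) : aexp :=
  match e with
  | Both e => Both (substs y x e)
  | Dom z w => Dom (substv y x z) w
  | Rel w v => Rel w v
  end.

Definition alphas (e e' : sexp) : Prop :=
  match e, e' with
  | Form w A, Form w' A' => w = w' /\ alphaf [::] A A'
  | Den t x w, Den t' x' w' => [/\ alphat [::] t t', x = x' & w = w']
  | _, _ => False
  end.
Definition alphaa (e e' : aexp) : Prop :=
  match e, e' with
  | Both e, Both e' => alphas e e'
  | Dom x w, Dom x' w' => x = x' /\ w = w'
  | Rel w v, Rel w' v' => w = w' /\ v = v'
  | _, _ => False
  end.
Definition alphaq (S S' : sequent) : Prop :=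
  List.Forall2 alphaa S.1 S'.1 /\ List.Forall2 alphas S.2 S'.2.

End Sequents.

Arguments Form {Sig ar V L} _ _.
Arguments Den {Sig ar V L} _ _ _.
Arguments Both {Sig ar V L} _.
Arguments Dom {Sig ar V L} _ _.
Arguments Rel {Sig ar V L} _ _.

Notation AForm w A := (Both (Form w A)).
Notation ADen t x w := (Both (Den t x w)).

(** * The calculi *)

(* The tag [Eucl] stands for the rule Eucl together with its contracted
   instance Eucl^c. *)
Inductive nlrule : Type := RefW | Ser | Trans | Eucl | Incr | Decr | Cons.

Section Calculus.

Variables (Sig : Type) (ar : Sig -> nat) (V L : eqType).

Local Notation form := (form ar V).
Local Notation term := (term ar V).
Local Notation sexp := (sexp ar V L).
Local Notation aexp := (aexp ar V L).
Local Notation sequent := (sequent ar V L).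

Inductive initial : sequent -> Prop :=
| IAtom w (p : form) (Γ : seq aexp) (Δ : seq sexp) :
    atomic p -> initial (AForm w p :: Γ, Form w p :: Δ)
| IDen y x w (Γ : seq aexp) (Δ : seq sexp) :
    initial (ADen (Var y) x w :: Γ, Den (Var y) x w :: Δ)
| IBot w (Γ : seq aexp) (Δ : seq sexp) :
    initial (AForm w Bot :: Γ, Δ).

(* The expressions E on which Repl (at label [w]) may act. *)
Definition replaceable (w : L) (E : aexp) : bool :=
  match E with
  | ADen (Var _) _ w' => w' == w
  | Dom _ w' => w' == w
  | AForm w' p => (w' == w) && atomic p
  | _ => false
  end.

(* [rule1 N P S]: the sequent [S] follows from the single premiss [P] by a
   rule of G3Ql.K + N.  A fresh variable is always free for [x], so this
   proviso on A[z/x] is not repeated when [z] is fresh. *)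
Inductive rule1 (N : nlrule -> Prop) : sequent -> sequent -> Prop :=
| LAnd w A B Γ Δ :
    rule1 N (AForm w A :: AForm w B :: Γ, Δ) (AForm w (And A B) :: Γ, Δ)
| ROr w A B Γ Δ :
    rule1 N (Γ, Form w A :: Form w B :: Δ) (Γ, Form w (Or A B) :: Δ)
| RImp w A B Γ Δ :
    rule1 N (AForm w A :: Γ, Form w B :: Δ) (Γ, Form w (Imp A B) :: Δ)
| LAll w x y A Γ Δ :
    free_forf y x A ->
    rule1 N (AForm w (substf y x A) :: Dom y w :: AForm w (All x A) :: Γ, Δ)
            (Dom y w :: AForm w (All x A) :: Γ, Δ)
| RAll w x z A Γ Δ :
    fresh z (Γ, Form w (All x A) :: Δ) ->
    rule1 N (Dom z w :: Γ, Form w (substf z x A) :: Δ)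
            (Γ, Form w (All x A) :: Δ)
| LEx w x z A Γ Δ :
    fresh z (AForm w (Ex x A) :: Γ, Δ) ->
    rule1 N (Dom z w :: AForm w (substf z x A) :: Γ, Δ)
            (AForm w (Ex x A) :: Γ, Δ)
| REx w x y A Γ Δ :
    free_forf y x A ->
    rule1 N (Dom y w :: Γ, Form w (Ex x A) :: Form w (substf y x A) :: Δ)
            (Dom y w :: Γ, Form w (Ex x A) :: Δ)
| LBox w v A Γ Δ :
    rule1 N (AForm v A :: Rel w v :: AForm w (Box A) :: Γ, Δ)
            (Rel w v :: AForm w (Box A) :: Γ, Δ)
| RBox w u A Γ Δ :
    freshl u (Γ, Form w (Box A) :: Δ) ->
    rule1 N (Rel w u :: Γ, Form u A :: Δ) (Γ, Form w (Box A) :: Δ)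
| LDia w u A Γ Δ :
    freshl u (AForm w (Dia A) :: Γ, Δ) ->
    rule1 N (Rel w u :: AForm u A :: Γ, Δ) (AForm w (Dia A) :: Γ, Δ)
| RDia w v A Γ Δ :
    rule1 N (Rel w v :: Γ, Form w (Dia A) :: Form v A :: Δ)
            (Rel w v :: Γ, Form w (Dia A) :: Δ)
| RefEq w x Γ Δ :
    rule1 N (AForm w (Eq x x) :: Γ, Δ) (Γ, Δ)
| RigVar w v y z Γ Δ :
    rule1 N (AForm v (Eq y z) :: AForm w (Eq y z) :: Γ, Δ)
            (AForm w (Eq y z) :: Γ, Δ)
| Repl w x y z E Γ Δ :
    replaceable w E ->
    rule1 N (substa z x E :: substa y x E :: AForm w (Eq y z) :: Γ, Δ)
            (substa y x E :: AForm w (Eq y z) :: Γ, Δ)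
| LLam w x z B t Γ Δ :
    fresh z (AForm w (Lam x B t) :: Γ, Δ) ->
    rule1 N (ADen t z w :: AForm w (substf z x B) :: Γ, Δ)
            (AForm w (Lam x B t) :: Γ, Δ)
| LD1 w x1 x2 A Γ Δ :
    free_forf x2 x1 A ->
    rule1 N (AForm w (substf x2 x1 A) :: ADen (Iota x1 A) x2 w :: Γ, Δ)
            (ADen (Iota x1 A) x2 w :: Γ, Δ)
| DenVar x w Γ Δ :
    rule1 N (ADen (Var x) x w :: Γ, Δ) (Γ, Δ)
| DenId x y w Γ Δ :
    rule1 N (AForm w (Eq y x) :: ADen (Var y) x w :: Γ, Δ)
            (ADen (Var y) x w :: Γ, Δ)
| NRefW w Γ Δ :
    N RefW ->
    rule1 N (Rel w w :: Γ, Δ) (Γ, Δ)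
| NSer w u Γ Δ :
    N Ser -> freshl u (Γ, Δ) ->
    rule1 N (Rel w u :: Γ, Δ) (Γ, Δ)
| NTrans w v u Γ Δ :
    N Trans ->
    rule1 N (Rel w u :: Rel w v :: Rel v u :: Γ, Δ)
            (Rel w v :: Rel v u :: Γ, Δ)
| NEucl w v u Γ Δ :
    N Eucl ->
    rule1 N (Rel v u :: Rel w v :: Rel w u :: Γ, Δ)
            (Rel w v :: Rel w u :: Γ, Δ)
| NEuclC w v Γ Δ :
    N Eucl ->
    rule1 N (Rel v v :: Rel w v :: Γ, Δ) (Rel w v :: Γ, Δ)
| NIncr x w v Γ Δ :
    N Incr ->
    rule1 N (Dom x v :: Dom x w :: Rel w v :: Γ, Δ)
            (Dom x w :: Rel w v :: Γ, Δ)
| NDecr x w v Γ Δ :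
    N Decr ->
    rule1 N (Dom x w :: Dom x v :: Rel w v :: Γ, Δ)
            (Dom x v :: Rel w v :: Γ, Δ)
| NCons x w Γ Δ :
    N Cons ->
    rule1 N (Dom x w :: Γ, Δ) (Γ, Δ).

(* [rule2 P1 P2 S]: the same, for the rules with two premisses. *)
Inductive rule2 : sequent -> sequent -> sequent -> Prop :=
| RAnd w A B Γ Δ :
    rule2 (Γ, Form w A :: Δ) (Γ, Form w B :: Δ) (Γ, Form w (And A B) :: Δ)
| LOr w A B Γ Δ :
    rule2 (AForm w A :: Γ, Δ) (AForm w B :: Γ, Δ) (AForm w (Or A B) :: Γ, Δ)
| LImp w A B Γ Δ :
    rule2 (Γ, Form w A :: Δ) (AForm w B :: Γ, Δ) (AForm w (Imp A B) :: Γ, Δ)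
| RLam w x y B t Γ Δ :
    free_forf y x B ->
    rule2 (Γ, Form w (Lam x B t) :: Den t y w :: Δ)
          (Γ, Form w (Lam x B t) :: Form w (substf y x B) :: Δ)
          (Γ, Form w (Lam x B t) :: Δ)
| LD2 w x1 x2 y A Γ Δ :
    free_forf y x1 A ->
    rule2 (ADen (Iota x1 A) x2 w :: Γ, Form w (substf y x1 A) :: Δ)
          (AForm w (Eq x2 y) :: ADen (Iota x1 A) x2 w :: Γ, Δ)
          (ADen (Iota x1 A) x2 w :: Γ, Δ)
| RD w x1 x2 z A Γ Δ :
    free_forf x2 x1 A ->
    fresh z (Γ, Den (Iota x1 A) x2 w :: Δ) ->
    rule2 (Γ, Form w (substf x2 x1 A) :: Δ)
          (AForm w (substf z x1 A) :: Γ, Form w (Eq x2 z) :: Δ)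
          (Γ, Den (Iota x1 A) x2 w :: Δ).

(* Derivations of G3Ql.K + N.  The [meq] in each constructor makes the two
   sides of a sequent multisets: permuting them is not an inference. *)
Inductive derivation (N : nlrule -> Prop) : sequent -> Type :=
| Leaf S0 S :
    initial S0 -> meq S0 S -> pure S -> derivation N S
| Node1 P S0 S :
    rule1 N P S0 -> meq S0 S -> pure S ->
    derivation N P -> derivation N S
| Node2 P1 P2 S0 S :
    rule2 P1 P2 S0 -> meq S0 S -> pure S ->
    derivation N P1 -> derivation N P2 -> derivation N S.

(* The number of nodes of a longest branch. *)
Fixpoint height N S (d : derivation N S) : nat :=
  match d with
  | Leaf _ _ _ _ _ => 1
  | Node1 _ _ _ _ _ _ d => (height d).+1
  | Node2 _ _ _ _ _ _ _ d1 d2 => (maxn (height d1) (height d2)).+1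
  end.

(* [S] is derivable with height (at most) [n]. *)
Definition derivable (N : nlrule -> Prop) (n : nat) (S : sequent) : Prop :=
  exists S' : sequent,
    alphaq S S' /\ exists d : derivation N S', height d <= n.

(* [R P S]: [S] follows from the premiss [P] by the rule R. *)
Definition hp_admissible (N : nlrule -> Prop)
    (R : sequent -> sequent -> Prop) : Prop :=
  forall (n : nat) (P S : sequent),
    R P S -> derivable N n P -> derivable N n S.

Inductive LW : sequent -> sequent -> Prop :=
| LW_intro (Γ Γ' : seq aexp) (Δ : seq sexp) : LW (Γ, Δ) (Γ' ++ Γ, Δ).

Inductive RW : sequent -> sequent -> Prop :=
| RW_intro (Γ : seq aexp) (Δ Δ' : seq sexp) : RW (Γ, Δ) (Γ, Δ ++ Δ').

End Calculus.

(* Main.v *)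
(** Everything in the calculus is equivariant: an injective renaming of all
    variables (free and bound alike) and labels maps derivations to derivations
    of the same height.  So weakening by [W] goes by induction on the height:
    before a premiss is weakened, it is renamed injectively so that the names of
    the conclusion stay fixed and all new ones avoid [W]; this repairs the
    freshness conditions of the rules.  No bound variable is ever created on the
    way up, so purity is preserved once the bound variables of the conclusion
    avoid the free ones of [W], and the bound variables of [W] avoid everything.
    Both can be arranged at the root by passing to alphabetic variants. *)
From Stdlib Require List Permutation.
From mathcomp Require Import boolp.
Require Import Defs.

Set Implicit Arguments.
Unset Strict Implicit.
Unset Printing Implicit Defensive.

(** * Injections that avoid some names and fix others *)

Section FreshRenaming.

Variables (T : eqType) (Tinf : infinite_set [set: T]%classic).

Lemma infinite_fresh (s : seq T) : exists y, y \notin s.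
Proof.
apply: contrapT => all_in; apply: Tinf; apply/finite_seqP; exists s.
apply/seteqP; split=> // x _ /=; apply: contrapT => /negP xs.
by apply: all_in; exists x.
Qed.

Definition swap (x y u : T) := if u == x then y else if u == y then x else u.

Lemma swapK x y : involutive (swap x y).
Proof.
move=> u; rewrite /swap; case: (eqVneq u x) => [->|ux].
  by rewrite eqxx; case: eqVneq.
case: (eqVneq u y) => [->|uy]; first by rewrite eqxx.
by rewrite (negPf ux) (negPf uy).
Qed.

(** Induction on [xs]. The map obtained for the larger list [x :: W] fixes [x] and keeps the images
    of [xs] away from it. Composing it with the transposition of [x] and a fresh [y] therefore sends
    [x] to [y] and disturbs neither those images nor the entries of [W] that must stay in place. *)
Lemma injection_off (xs W : seq T) :
  exists f : T -> T, [/\ injective f, forall x, x \in xs -> f x \notin W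
    & forall x, x \in W -> x \notin xs -> f x = x].
Proof.
elim: xs W => [|x xs IH] W; first by exists id; split.
have [xxs|xxs] := boolP (x \in xs).
  have [f [fI f1 f2]] := IH W; exists f; split=> // u.
    by rewrite inE => /orP[/eqP->|]; apply: f1.
  by move=> uW; rewrite inE negb_or => /andP[_]; apply: f2.
have [f [fI f1 f2]] := IH (x :: W).
have [y] := infinite_fresh (W ++ x :: map f xs).
rewrite mem_cat inE !negb_or => /and3P[yW yx yf].
exists (swap x y \o f); split.
- by apply: inj_comp => //; apply: inv_inj; apply: swapK.
- move=> u; rewrite inE => /orP[/eqP->|uxs] /=.
    by rewrite f2 ?mem_head // /swap eqxx.
  have := f1 _ uxs; rewrite inE negb_or => /andP[fux fuW].
  rewrite /swap (negPf fux); case: eqP => // fuy.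
  by rewrite -fuy map_f in yf.
- move=> u uW; rewrite inE negb_or => /andP[ux uxs] /=.
  rewrite f2 ?inE ?uW ?orbT // /swap (negPf ux).
  by case: eqP => // uy; rewrite -uy uW in yW.
Qed.

(** Only the entries of [W] outside [F] have to move. A name of [Q] is thus either moved off [W] or
    fixed, and in the latter case it lies in [F] or outside [W]. *)
Lemma injection_fixing (F W Q : seq T) :
  exists f : T -> T, [/\ injective f, forall x, x \in F -> f x = x
    & forall x, x \in Q -> f x \in F \/ f x \notin W].
Proof.
(* [F] and [Q] are put into the list to be avoided because [injection_off] promises fixed points
   only among the members of that list. *)
have [f [fI f1 f2]] := injection_off [seq x <- W | x \notin F] (F ++ W ++ Q).
exists f; split=> // x xin.
  by apply: f2; rewrite ?mem_cat ?xin // mem_filter xin.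
have [xW|xW] := boolP (x \in [seq x <- W | x \notin F]).
  by have := f1 _ xW; rewrite !mem_cat !negb_or => /and3P[_ ? _]; right.
rewrite f2 // ?mem_cat ?xin ?orbT //.
move: xW; rewrite mem_filter negb_and negbK.
by case/orP; [left|right].
Qed.

End FreshRenaming.

(* Equivariance of syntax, rules and derivations *)
Scheme term_form_ind := Induction for term Sort Prop
  with form_term_ind := Induction for form Sort Prop.
Combined Scheme term_form_mutind from term_form_ind, form_term_ind.

Section Renaming.

Variables (Sig : Type) (ar : Sig -> nat) (V L : eqType).

Local Notation form := (form ar V).
Local Notation term := (term ar V).
Local Notation sexp := (sexp ar V L).
Local Notation aexp := (aexp ar V L).
Local Notation sequent := (sequent ar V L).

Implicit Types (A B : form) (t : term) (S P W : sequent).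

Definition vq S : seq V := fvq S ++ bvq S.

Section Injective.

Variables (f : V -> V) (g : L -> L).

(** Binders are renamed by the same [f] as free occurrences, so an injective [f] can neither capture
    nor release a variable. *)
Fixpoint mapt t : term :=
  match t with
  | Var x => Var (f x)
  | Iota x A => Iota (f x) (mapf A)
  end
with mapf A : form :=
  match A with
  | Pred p xs => Pred p (map_tuple f xs)
  | Eq x y => Eq (f x) (f y)
  | Bot => Bot
  | And A B => And (mapf A) (mapf B)
  | Or A B => Or (mapf A) (mapf B)
  | Imp A B => Imp (mapf A) (mapf B)
  | All x A => All (f x) (mapf A)
  | Ex x A => Ex (f x) (mapf A)
  | Box A => Box (mapf A)
  | Dia A => Dia (mapf A)
  | Lam x A t => Lam (f x) (mapf A) (mapt t)
  end.

Definition maps (e : sexp) : sexp :=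
  match e with
  | Form w A => Form (g w) (mapf A)
  | Den t x w => Den (mapt t) (f x) (g w)
  end.

Definition mapa (e : aexp) : aexp :=
  match e with
  | Both e => Both (maps e)
  | Dom x w => Dom (f x) (g w)
  | Rel w v => Rel (g w) (g v)
  end.

Definition mapq S : sequent := (map mapa S.1, map maps S.2).

Lemma bv_map : (forall t, bvt (mapt t) = map f (bvt t))
  /\ (forall A, bvf (mapf A) = map f (bvf A)).
Proof.
by apply: term_form_mutind => //= *; rewrite ?map_cat; congruence.
Qed.

Lemma map_id_on :
  (forall t, {in fvt t ++ bvt t, f =1 id} -> mapt t = t)
  /\ (forall A, {in fvf A ++ bvf A, f =1 id} -> mapf A = A).
Proof.
(* Passage under a binder: a free variable of the body is [x] or stays free outside, and [x] itself
   is listed among the bound variables, so [f] fixes it in both cases. *)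
have bind x A s : {in [seq y <- fvf A | y != x] ++ x :: s, f =1 id} ->
    {in bvf A, forall y, y \in s} -> {in fvf A ++ bvf A, f =1 id}.
  move=> fid sub y; rewrite mem_cat => /orP[yA|/sub ys].
    apply: fid; rewrite mem_cat mem_filter inE yA andbT.
    by case: eqP.
  by apply: fid; rewrite mem_cat inE ys !orbT.
have bindx x A s : {in [seq y <- fvf A | y != x] ++ x :: s, f =1 id} ->
    f x = x by apply; rewrite mem_cat mem_head orbT.
apply: term_form_mutind => //=.
- by move=> x fid; rewrite fid ?inE.
- by move=> x A IH fid; rewrite (bindx _ _ _ fid) IH //; apply: bind fid _.
- move=> p xs; rewrite cats0 => fid; congr Pred; apply: val_inj => /=.
  by rewrite -[RHS]map_id; apply/eq_in_map.
- by move=> x y fid; rewrite !fid ?inE ?eqxx ?orbT.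
- by move=> A IHA B IHB fid; rewrite IHA ?IHB // => x xin; apply: fid;
    move: xin; rewrite !mem_cat => /orP[]->; rewrite ?orbT.
- by move=> A IHA B IHB fid; rewrite IHA ?IHB // => x xin; apply: fid;
    move: xin; rewrite !mem_cat => /orP[]->; rewrite ?orbT.
- by move=> A IHA B IHB fid; rewrite IHA ?IHB // => x xin; apply: fid;
    move: xin; rewrite !mem_cat => /orP[]->; rewrite ?orbT.
- by move=> x A IH fid; rewrite (bindx _ _ _ fid) IH //; apply: bind fid _.
- by move=> x A IH fid; rewrite (bindx _ _ _ fid) IH //; apply: bind fid _.
- by move=> A IH fid; rewrite IH.
- by move=> A IH fid; rewrite IH.
- move=> x A IHA t IHt fid.
  have fid' : {in [seq y <- fvf A | y != x] ++ x :: bvf A, f =1 id}.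
    move=> y yin; apply: fid; move: yin.
    by rewrite !mem_cat !inE !mem_cat => /or3P[]->; rewrite ?orbT.
  rewrite (bindx _ _ _ fid') IHA ?IHt //; last exact: bind fid' _.
  move=> y yin; apply: fid; move: yin.
  by rewrite !mem_cat !inE !mem_cat => /orP[]->; rewrite ?orbT.
Qed.

Hypothesis fI : injective f.

Lemma filter_neq_map x (s : seq V) :
  [seq y <- map f s | y != f x] = map f [seq y <- s | y != x].
Proof.
by rewrite filter_map; congr map; apply: eq_filter => y /=; rewrite inj_eq.
Qed.

Lemma fv_map : (forall t, fvt (mapt t) = map f (fvt t))
  /\ (forall A, fvf (mapf A) = map f (fvf A)).
Proof.
by apply: term_form_mutind => //= *; rewrite ?map_cat -?filter_neq_map; congruence.
Qed.

Lemma substv_map y x z : f (substv y x z) = substv (f y) (f x) (f z).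
Proof. by rewrite /substv inj_eq //; case: ifP. Qed.

(** Injectivity preserves the outcome of every test [z == x] by which substitution decides whether
    to replace a variable or to stop at a binder. *)
Lemma subst_map y x :
  (forall t, mapt (substt y x t) = substt (f y) (f x) (mapt t))
  /\ (forall A, mapf (substf y x A) = substf (f y) (f x) (mapf A)).
Proof.
have bind z A : mapf (substf y x A) = substf (f y) (f x) (mapf A) ->
    mapf (if z == x then A else substf y x A)
    = if f z == f x then mapf A else substf (f y) (f x) (mapf A).
  by rewrite inj_eq //; case: ifP.
apply: term_form_mutind => //= *; rewrite ?substv_map ?bind //; try congruence.
congr Pred; apply: val_inj => /=; rewrite -!map_comp.
by apply: eq_map => z /=; rewrite substv_map.
Qed.

Lemma free_for_map y x :
  (forall t, free_fort (f y) (f x) (mapt t) = free_fort y x t)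
  /\ (forall A, free_forf (f y) (f x) (mapf A) = free_forf y x A).
Proof.
apply: term_form_mutind => //= *; rewrite ?fv_map.2 ?inj_eq ?mem_map //; congruence.
Qed.

Lemma fvs_map e : fvs (maps e) = map f (fvs e).
Proof. by case: e => [w A|t x w] /=; rewrite ?fv_map.1 ?fv_map.2. Qed.

Lemma bvs_map e : bvs (maps e) = map f (bvs e).
Proof. by case: e => [w A|t x w] /=; rewrite ?bv_map.1 ?bv_map.2. Qed.

Lemma fva_map e : fva (mapa e) = map f (fva e).
Proof. by case: e => //= e; rewrite fvs_map. Qed.

Lemma bva_map e : bva (mapa e) = map f (bva e).
Proof. by case: e => //= e; rewrite bvs_map. Qed.

Lemma flatten_map_comm (X Y : Type) (h : X -> X) (k : X -> seq Y) (m : Y -> Y)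
    (s : seq X) :
  (forall x, k (h x) = map m (k x)) ->
  flatten (map k (map h s)) = map m (flatten (map k s)).
Proof. by move=> kh; elim: s => //= x s ->; rewrite map_cat kh. Qed.

Lemma fvq_map S : fvq (mapq S) = map f (fvq S).
Proof.
rewrite /fvq /= (flatten_map_comm _ fva_map) (flatten_map_comm _ fvs_map).
by rewrite map_cat.
Qed.

Lemma bvq_map S : bvq (mapq S) = map f (bvq S).
Proof.
rewrite /bvq /= (flatten_map_comm _ bva_map) (flatten_map_comm _ bvs_map).
by rewrite map_cat.
Qed.

Lemma vq_map S : vq (mapq S) = map f (vq S).
Proof. by rewrite /vq fvq_map bvq_map map_cat. Qed.

Lemma labq_map S : labq (mapq S) = map g (labq S).
Proof.
rewrite /labq /= (flatten_map_comm (m := g)); last first.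
  by case=> [[]|?|?] //=.
rewrite (flatten_map_comm (m := g)); last by case.
by rewrite map_cat.
Qed.

Lemma pure_map S : pure S -> pure (mapq S).
Proof.
move=> pS x; rewrite fvq_map bvq_map.
apply/negP => /andP[/mapP[u uF ->]]; rewrite mem_map // => uB.
by have := pS u; rewrite uF uB.
Qed.

Lemma fresh_map z S : fresh (f z) (mapq S) = fresh z S.
Proof. by rewrite /fresh fvq_map bvq_map !mem_map. Qed.

Lemma meq_map S S' : meq S S' -> meq (mapq S) (mapq S').
Proof. by case=> p1 p2; split; apply: Permutation.Permutation_map. Qed.

Lemma atomic_map A : atomic (mapf A) = atomic A.
Proof. by case: A. Qed.

Lemma initial_map S : initial S -> initial (mapq S).
Proof.
case=> *; rewrite /mapq /=; constructor => //.
by rewrite atomic_map.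
Qed.

Lemma substa_map y x e : mapa (substa y x e) = substa (f y) (f x) (mapa e).
Proof.
case: e => [[w A|t z w]|z w|//] /=;
by rewrite ?(subst_map _ _).1 ?(subst_map _ _).2 ?substv_map.
Qed.

Hypothesis gI : injective g.

Lemma freshl_map u S : freshl (g u) (mapq S) = freshl u S.
Proof. by rewrite /freshl labq_map mem_map. Qed.

Lemma replaceable_map w e : replaceable (g w) (mapa e) = replaceable w e.
Proof.
by case: e => [[v A|[x|x A] y v]|x v|] //=; rewrite ?inj_eq ?atomic_map.
Qed.

(** The image is an instance of the same rule: substitution commutes with the renaming, and being
    free for a variable, freshness, [atomic] and [replaceable] are all invariant under it. *)
Lemma rule1_map N P S : rule1 N P S -> rule1 N (mapq P) (mapq S).
Proof.
have fr z X : fresh z X -> fresh (f z) (mapq X) by rewrite fresh_map.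
have frl u X : freshl u X -> freshl (g u) (mapq X) by rewrite freshl_map.
case=> *; rewrite /mapq /= ?(subst_map _ _).2 ?substa_map //;
  solve [econstructor; rewrite ?(free_for_map _ _).2 ?replaceable_map //;
    match goal with
    | H : is_true (fresh _ _) |- _ => exact (fr _ _ H)
    | H : is_true (freshl _ _) |- _ => exact (frl _ _ H)
    end].
Qed.

Lemma rule2_map P1 P2 S : rule2 P1 P2 S -> rule2 (mapq P1) (mapq P2) (mapq S).
Proof.
have fr z X : fresh z X -> fresh (f z) (mapq X) by rewrite fresh_map.
case=> *; rewrite /mapq /= ?(subst_map _ _).2 //;
  solve [econstructor; rewrite ?(free_for_map _ _).2 //;
    match goal with H : is_true (fresh _ _) |- _ => exact (fr _ _ H) end].
Qed.

Lemma derivation_map N S (d : derivation N S) :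
  exists d' : derivation N (mapq S), height d' = height d.
Proof.
elim: S / d => [S0 S i m p|P S0 S r m p d [d' hd]
                 |P1 P2 S0 S r m p d1 [d1' hd1] d2 [d2' hd2]].
- by exists (Leaf N (initial_map i) (meq_map m) (pure_map p)).
- by exists (Node1 (rule1_map r) (meq_map m) (pure_map p) d'); rewrite /= hd.
- by exists (Node2 (rule2_map r) (meq_map m) (pure_map p) d1' d2'); rewrite /= hd1 hd2.
Qed.

(** * Alphabetic variants obtained by injective renaming *)

Lemma alphav_map (r : seq (V * V)) x y :
  alphav r x y -> (y \notin unzip2 r -> f y = y) ->
  alphav [seq (p.1, f p.2) | p <- r] x (f y).
Proof.
elim: r => [/eqP-> -> /=|[a b] r IH /=]; rewrite ?eqxx //.
rewrite (inj_eq fI); case: ifP => // /norP[_ yb] /IH{}IH fy.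
by apply: IH => yr; apply: fy; rewrite inE negb_or yb.
Qed.

(** The second components of the recorded binder pairs are renamed along with the occurrences.
    Injectivity keeps bound occurrences tied to their own binders, while an occurrence bound by no
    recorded binder has to equal its partner and so must be fixed. *)
Lemma alpha_map :
  (forall t r t', alphat r t t' ->
     (forall y, y \in fvt t' -> y \notin unzip2 r -> f y = y) ->
     alphat [seq (p.1, f p.2) | p <- r] t (mapt t'))
  /\ (forall A r A', alphaf r A A' ->
     (forall y, y \in fvf A' -> y \notin unzip2 r -> f y = y) ->
     alphaf [seq (p.1, f p.2) | p <- r] A (mapf A')).
Proof.
have bind x (r : seq (V * V)) x' (s : seq V) :
    (forall y, y \in [seq z <- s | z != x'] -> y \notin unzip2 r -> f y = y) ->
    forall y, y \in s -> y \notin unzip2 ((x, x') :: r) -> f y = y.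
  move=> fid y ys; rewrite inE negb_or => /andP[yx yr].
  by apply: fid => //; rewrite mem_filter yx.
have sub (r : seq (V * V)) (s s' : seq V) :
    (forall y, y \in s' -> y \notin unzip2 r -> f y = y) -> {subset s <= s'} ->
    forall y, y \in s -> y \notin unzip2 r -> f y = y.
  by move=> fid ss y /ss; apply: fid.
apply: term_form_mutind => /=.
- by move=> x r [y|//] /= xy fid; apply: alphav_map => // ; apply: fid; rewrite inE.
- by move=> x A IH r [//|y B] /= AB fid; apply: IH AB _; apply: bind fid.
- move=> p xs r [] //= q ys [pq xy] fid; split=> //.
  elim: (tval xs) (tval ys) xy fid => [|x s IH] [|y s'] //= /andP[xy ss] fid.
  apply/andP; split.
    by apply: alphav_map => //; apply: fid; rewrite mem_head.
  by apply: IH => // z zs; apply: fid; rewrite inE zs orbT.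
- move=> x y r [] //= x' y' [xx yy] fid; split; apply: alphav_map => //;
  by apply: fid; rewrite !inE eqxx ?orbT.
- by move=> r [].
- by move=> A IHA B IHB r [] //= A' B' [a b] fid; split;
    [apply: IHA a _|apply: IHB b _]; apply: sub fid _ => z zz;
    rewrite mem_cat zz ?orbT.
- by move=> A IHA B IHB r [] //= A' B' [a b] fid; split;
    [apply: IHA a _|apply: IHB b _]; apply: sub fid _ => z zz;
    rewrite mem_cat zz ?orbT.
- by move=> A IHA B IHB r [] //= A' B' [a b] fid; split;
    [apply: IHA a _|apply: IHB b _]; apply: sub fid _ => z zz;
    rewrite mem_cat zz ?orbT.
- by move=> x A IH r [] //= y B AB fid; apply: IH AB _; apply: bind fid.
- by move=> x A IH r [] //= y B AB fid; apply: IH AB _; apply: bind fid.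
- by move=> A IH r [] //= B AB fid; apply: IH AB _.
- by move=> A IH r [] //= B AB fid; apply: IH AB _.
- move=> x A IHA t IHt r [] //= y B t' [AB tt] fid; split.
    by apply: IHA AB _; apply: bind; apply: sub fid _ => z zz;
      rewrite mem_cat zz.
  by apply: IHt tt _; apply: sub fid _ => z zz; rewrite mem_cat zz orbT.
Qed.

(** Alphabetic variance leaves labels alone, hence the restriction to a [g] that acts as the
    identity. *)
Lemma alphas_map e e' :
  g =1 id -> alphas e e' -> {in fvs e', f =1 id} -> alphas e (maps e').
Proof.
move=> gid; case: e e' => [w A|t x w] [w' A'|t' x' w'] //=; rewrite gid.
  by move=> [-> a] fid; split=> //; apply: (alpha_map.2 _ [::]) => // y yA _; apply: fid.
move=> [a -> ->] fid; split=> //; last by rewrite fid ?mem_head.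
by apply: (alpha_map.1 _ [::]) => // y yt _; apply: fid; rewrite inE yt orbT.
Qed.

Lemma alphaa_map e e' :
  g =1 id -> alphaa e e' -> {in fva e', f =1 id} -> alphaa e (mapa e').
Proof.
move=> gid; case: e e' => [e|x w|w v] [e'|x' w'|w' v'] //=.
- exact: alphas_map.
- by rewrite gid => -[-> ->] fid; rewrite fid ?mem_head.
- by rewrite !gid.
Qed.

Lemma alphaq_map S S' :
  g =1 id -> alphaq S S' -> {in fvq S', f =1 id} -> alphaq S (mapq S').
Proof.
case: S S' => [Γ Δ] [Γ' Δ'] gid [/= aΓ aΔ] fid; split=> /=.
  have {}fid : {in flatten (map (@fva _ _ _ _) Γ'), f =1 id}.
    by move=> x xin; apply: fid; rewrite mem_cat xin.
  elim: aΓ fid {aΔ} => //= e e' s s' ee ss IH fid; constructor.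
    by apply: alphaa_map => // x xin; apply: fid; rewrite mem_cat xin.
  by apply: IH => x xin; apply: fid; rewrite mem_cat xin orbT.
have {}fid : {in flatten (map (@fvs _ _ _ _) Δ'), f =1 id}.
  by move=> x xin; apply: fid; rewrite mem_cat xin orbT.
elim: aΔ fid {aΓ} => //= e e' s s' ee ss IH fid; constructor.
  by apply: alphas_map => // x xin; apply: fid; rewrite mem_cat xin.
by apply: IH => x xin; apply: fid; rewrite mem_cat xin orbT.
Qed.

End Injective.

(** This keeps the conclusion of an inference literally the same when its premisses are renamed. *)
Lemma mapq_id_on (f : V -> V) (g : L -> L) S :
  {in vq S, f =1 id} -> {in labq S, g =1 id} -> mapq f g S = S.
Proof.
have ids (e : sexp) : {in fvs e ++ bvs e, f =1 id} -> {in labs e, g =1 id} ->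
    maps f g e = e.
  case: e => [w A|t x w] /= fid gid; rewrite gid ?mem_head //.
    by rewrite (map_id_on f).2.
  by rewrite fid ?mem_head // (map_id_on f).1 // => y yin; apply: fid;
    rewrite inE yin orbT.
have ida (e : aexp) : {in fva e ++ bva e, f =1 id} -> {in laba e, g =1 id} ->
    mapa f g e = e.
  case: e => [e|x w|w v] /= fid gid; first by rewrite ids.
    by rewrite fid ?gid ?mem_head.
  by rewrite !gid ?inE ?eqxx ?orbT.
case: S => Γ Δ fid gid; congr pair; rewrite /= -[RHS]map_id.
  elim: Γ fid gid => //= e s IH fid gid; rewrite ida ?IH //.
  - by move=> x xin; apply: fid; move: xin;
      rewrite /vq /fvq /bvq /= !mem_cat => /orP[/orP[]|/orP[]] ->; rewrite ?orbT.
  - by move=> x xin; apply: gid; move: xin;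
      rewrite /labq /= !mem_cat => /orP[] ->; rewrite ?orbT.
  - by move=> x xin; apply: fid; move: xin;
      rewrite /vq /fvq /bvq /= !mem_cat => /orP[] ->; rewrite ?orbT.
  - by move=> x xin; apply: gid; rewrite /labq /= !mem_cat xin.
elim: Δ fid gid => //= e s IH fid gid; rewrite ids ?IH //.
- by move=> x xin; apply: fid; move: xin;
    rewrite /vq /fvq /bvq /= !mem_cat => /orP[/orP[]|/orP[]] ->; rewrite ?orbT.
- by move=> x xin; apply: gid; move: xin;
    rewrite /labq /= !mem_cat => /orP[] ->; rewrite ?orbT.
- by move=> x xin; apply: fid; move: xin;
    rewrite /vq /fvq /bvq /= !mem_cat => /orP[] ->; rewrite ?orbT.
- by move=> x xin; apply: gid; rewrite /labq /= !mem_cat xin ?orbT.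
Qed.

(** * Renaming of bound variables alone *)

Section BinderRenaming.

Variable (h : V -> V).

(* Here free variables are renamed by [k] and bound ones by [h]: unlike [mapf],
   this yields alphabetic variants even of formulas in which some variable is
   both free and bound. *)
Definition upd (k : V -> V) (x y : V) : V := if y == x then h x else k y.

Fixpoint rent (k : V -> V) t : term :=
  match t with
  | Var x => Var (k x)
  | Iota x A => Iota (h x) (renf (upd k x) A)
  end
with renf (k : V -> V) A : form :=
  match A with
  | Pred p xs => Pred p (map_tuple k xs)
  | Eq x y => Eq (k x) (k y)
  | Bot => Bot
  | And A B => And (renf k A) (renf k B)
  | Or A B => Or (renf k A) (renf k B)
  | Imp A B => Imp (renf k A) (renf k B)
  | All x A => All (h x) (renf (upd k x) A)
  | Ex x A => Ex (h x) (renf (upd k x) A)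
  | Box A => Box (renf k A)
  | Dia A => Dia (renf k A)
  | Lam x A t => Lam (h x) (renf (upd k x) A) (rent k t)
  end.

Lemma bv_ren : (forall t k, bvt (rent k t) = map h (bvt t))
  /\ (forall A k, bvf (renf k A) = map h (bvf A)).
Proof.
apply: term_form_mutind => //= *; rewrite ?map_cat;
  repeat match goal with H : forall k, _ = _ |- _ => rewrite H; clear H end;
  by [].
Qed.

(** Only an inclusion: a free variable that [k] sends to [h x] is captured under a binder of [x]. *)
Lemma fv_ren : (forall t k, {subset fvt (rent k t) <= map k (fvt t)})
  /\ (forall A k, {subset fvf (renf k A) <= map k (fvf A)}).
Proof.
have bind (k : V -> V) x A : {subset fvf (renf (upd k x) A) <= map (upd k x) (fvf A)} ->
    {subset [seq y <- fvf (renf (upd k x) A) | y != h x]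
       <= map k [seq y <- fvf A | y != x]}.
  move=> IH y; rewrite mem_filter => /andP[yx /IH/mapP[z zA yE]].
  move: yE yx; rewrite /upd; case: (eqVneq z x) => [_ ->|zx -> _].
    by rewrite eqxx.
  by apply: map_f; rewrite mem_filter zx.
have cat (s1 s2 s1' s2' : seq V) : {subset s1 <= s1'} -> {subset s2 <= s2'} ->
    {subset s1 ++ s2 <= s1' ++ s2'}.
  by move=> s11 s22 x; rewrite !mem_cat => /orP[/s11|/s22] ->; rewrite ?orbT.
by apply: term_form_mutind => //= *; rewrite ?map_cat; auto.
Qed.

Hypothesis hI : injective h.

(** The first condition forbids capture. Its guard [x != y] makes it stable under binders: below a
    binder of [x] the variable [x] is itself sent to [h x], and injectivity of [h] separates this
    from the images of the other bound variables. Every other free variable misses both components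
    of the new pair [(x, h x)] and is looked up in [r] as before. *)
Lemma alpha_ren :
  (forall t k r, {in fvt t & bvt t, forall y x, x != y -> k y != h x} ->
     {in fvt t, forall y, alphav r y (k y)} -> alphat r t (rent k t))
  /\ (forall A k r, {in fvf A & bvf A, forall y x, x != y -> k y != h x} ->
     {in fvf A, forall y, alphav r y (k y)} -> alphaf r A (renf k A)).
Proof.
have bind x A (s : seq V) (IH : forall k r,
      {in fvf A & bvf A, forall y x, x != y -> k y != h x} ->
      {in fvf A, forall y, alphav r y (k y)} -> alphaf r A (renf k A)) k r :
    {subset bvf A <= s} ->
    {in [seq y <- fvf A | y != x] & x :: s,
       forall y x, x != y -> k y != h x} ->
    {in [seq y <- fvf A | y != x], forall y, alphav r y (k y)} ->
    alphaf ((x, h x) :: r) A (renf (upd k x) A).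
  move=> sub k1 k2; apply: IH => [y z yA zA zy|y yA] /=; rewrite /upd.
    case: (eqVneq y x) => [yx|yx]; first by rewrite inj_eq // eq_sym -yx.
    by apply: k1 => //; rewrite ?mem_filter ?yx // inE sub ?orbT.
  case: (eqVneq y x) => [->|yx] /=; first by rewrite !eqxx.
  rewrite (negPf (k1 _ x _ _ _)) ?mem_filter ?yx ?mem_head //; last by rewrite eq_sym.
  by apply: k2; rewrite mem_filter yx.
have sub2 (k : V -> V) (s1 s2 s1' s2' : seq V) :
    {in s1' & s2', forall y x, x != y -> k y != h x} ->
    {subset s1 <= s1'} -> {subset s2 <= s2'} ->
    {in s1 & s2, forall y x, x != y -> k y != h x}.
  by move=> H s11 s22 y x /s11 yin /s22; apply: H.
have sub1 (k : V -> V) r (s s' : seq V) : {in s', forall y, alphav r y (k y)} ->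
    {subset s <= s'} -> {in s, forall y, alphav r y (k y)}.
  by move=> H ss y /ss; apply: H.
have catl (s1 s2 : seq V) : {subset s1 <= s1 ++ s2}.
  by move=> x xin; rewrite mem_cat xin.
have catr (s1 s2 : seq V) : {subset s2 <= s1 ++ s2}.
  by move=> x xin; rewrite mem_cat xin orbT.
apply: term_form_mutind => //=.
- by move=> x k r _; apply; rewrite inE.
- by move=> x A IH k r; apply: bind.
- move=> p xs k r _ kr; split=> //.
  elim: (tval xs) kr => //= x s IH kr; rewrite kr ?mem_head //=.
  by apply: IH => y ys; apply: kr; rewrite inE ys orbT.
- by move=> x y k r _ kr; split; apply: kr; rewrite !inE eqxx ?orbT.
- by move=> A IHA B IHB k r k1 k2; split; [apply: IHA|apply: IHB];
    by [apply: sub2 k1 _ _|apply: sub1 k2 _].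
- by move=> A IHA B IHB k r k1 k2; split; [apply: IHA|apply: IHB];
    by [apply: sub2 k1 _ _|apply: sub1 k2 _].
- by move=> A IHA B IHB k r k1 k2; split; [apply: IHA|apply: IHB];
    by [apply: sub2 k1 _ _|apply: sub1 k2 _].
- by move=> x A IH k r; apply: bind.
- by move=> x A IH k r; apply: bind.
- move=> x A IHA t IHt k r k1 k2; split.
    (* The hypothesis speaks of the bound variables of body and argument together, which is why
       [bind] admits a list larger than [bvf A]. *)
    apply: (bind x A (bvf A ++ bvt t)) => //; first by apply: sub2 k1 _ _.
    by apply: sub1 k2 _.
  apply: IHt; last by apply: sub1 k2 _.
  by apply: sub2 k1 _ _ => // y yin; rewrite inE mem_cat yin !orbT.
Qed.

Definition rens (e : sexp) : sexp :=
  match e with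
  | Form w A => Form w (renf id A)
  | Den t x w => Den (rent id t) x w
  end.

Definition rena (e : aexp) : aexp :=
  if e is Both e then Both (rens e) else e.

Definition renq S : sequent := (map rena S.1, map rens S.2).

Lemma bvq_ren S : bvq (renq S) = map h (bvq S).
Proof.
have bs e : bvs (rens e) = map h (bvs e).
  by case: e => * /=; rewrite ?bv_ren.1 ?bv_ren.2.
rewrite /bvq /= (flatten_map_comm _ (m := h)); last by case.
by rewrite (flatten_map_comm _ bs) map_cat.
Qed.

Lemma fvq_ren S : {subset fvq (renq S) <= fvq S}.
Proof.
have fs e : {subset fvs (rens e) <= fvs e}.
  case: e => [w A|t x w] y /=; first by move/fv_ren.2; rewrite map_id.
  by rewrite !inE => /orP[->//|/fv_ren.1]; rewrite map_id => ->; rewrite orbT.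
have fl (X : Type) (k : X -> seq V) (m : X -> X) (s : seq X) :
    (forall e, {subset k (m e) <= k e}) ->
    {subset flatten (map k (map m s)) <= flatten (map k s)}.
  move=> km; elim: s => //= e s IH x; rewrite !mem_cat.
  by case/orP => [/km|/IH] ->; rewrite ?orbT.
move=> x; rewrite !mem_cat => /orP[]; last by move/(fl _ _ _ _ fs) => ->; rewrite orbT.
by move/fl => -> //; case=> [e|z w|w v] //=; exact: fs.
Qed.

Lemma alphaq_ren S :
  (forall x y, x \in bvq S -> y \in fvq S -> y != h x) -> alphaq S (renq S).
Proof.
have as_ e : (forall x y, x \in bvs e -> y \in fvs e -> y != h x) ->
    alphas e (rens e).
  case: e => [w A|t x w] /= H; split=> //.
    by apply: alpha_ren.2 => //= y x yA xA _; apply: H.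
  by apply: alpha_ren.1 => //= y z yA zA _; apply: H; rewrite // inE yA orbT.
have aa e : (forall x y, x \in bva e -> y \in fva e -> y != h x) ->
    alphaa e (rena e) by case: e => //= e; apply: as_.
case: S => [Γ Δ] H; split=> /=.
  have {}H x y : x \in flatten (map (@bva _ _ _ _) Γ) ->
      y \in flatten (map (@fva _ _ _ _) Γ) -> y != h x.
    by move=> xin yin; apply: H; rewrite mem_cat ?xin ?yin.
  elim: Γ H => //= e s IH H; constructor.
    by apply: aa => x y xin yin; apply: H; rewrite mem_cat ?xin ?yin.
  by apply: IH => x y xin yin; apply: H; rewrite mem_cat ?xin ?yin orbT.
have {}H x y : x \in flatten (map (@bvs _ _ _ _) Δ) ->
    y \in flatten (map (@fvs _ _ _ _) Δ) -> y != h x.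
  by move=> xin yin; apply: H; rewrite mem_cat ?xin ?yin orbT.
elim: Δ H => //= e s IH H; constructor.
  by apply: as_ => x y xin yin; apply: H; rewrite mem_cat ?xin ?yin.
by apply: IH => x y xin yin; apply: H; rewrite mem_cat ?xin ?yin orbT.
Qed.

End BinderRenaming.

(** * Permuted sequents, and bound variables of premisses *)

Lemma mem_flatten_perm (T : eqType) (X : Type) (k : X -> seq T) (s s' : seq X) :
  Permutation.Permutation s s' ->
  flatten (map k s) =i flatten (map k s').
Proof.
elim=> //= [e s1 s2 _ IH|e e' s1|s1 s2 s3 _ IH1 _ IH2] x.
- by rewrite !mem_cat IH.
- by rewrite !mem_cat orbCA.
- by rewrite IH1 IH2.
Qed.

Lemma vq_meq S S' : meq S S' -> vq S =i vq S'.
Proof.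
by case=> p1 p2 x; rewrite !mem_cat (mem_flatten_perm _ p1)
  (mem_flatten_perm _ p2) (mem_flatten_perm _ p1) (mem_flatten_perm _ p2).
Qed.

Lemma bvq_meq S S' : meq S S' -> bvq S =i bvq S'.
Proof.
by case=> p1 p2 x; rewrite !mem_cat (mem_flatten_perm _ p1) (mem_flatten_perm _ p2).
Qed.

(** The permutation is absorbed by the [meq] stored in the last inference, so no node is added. *)
Lemma derivation_meq N S S' (d : derivation N S) :
  meq S S' -> pure S' -> exists d' : derivation N S', height d' = height d.
Proof.
have tr S1 S2 S3 : meq S1 S2 -> meq S2 S3 -> meq S1 S3.
  by case=> p1 p2 [q1 q2]; split;
    [apply: Permutation.Permutation_trans p1 q1
    |apply: Permutation.Permutation_trans p2 q2].
case: d => [S0 {}S i m p|P S0 {}S r m p d|P1 P2 S0 {}S r m p d1 d2] mS pS'.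
- by exists (Leaf N i (tr _ _ _ m mS) pS').
- by exists (Node1 r (tr _ _ _ m mS) pS' d).
- by exists (Node2 r (tr _ _ _ m mS) pS' d1 d2).
Qed.

Lemma bv_subst y x : (forall t, bvt (substt y x t) = bvt t)
  /\ (forall A, bvf (substf y x A) = bvf A).
Proof.
apply: term_form_mutind => //= *; rewrite ?(fun_if (@bvf _ _ _));
  try case: ifP => _; congruence.
Qed.

Lemma bva_subst y x (e : aexp) : bva (substa y x e) = bva e.
Proof. by case: e => [[w A|t z w]|z w|w v] //=; rewrite ?(bv_subst _ _).1 ?(bv_subst _ _).2. Qed.

(** New expressions of a premiss are instances of parts of the conclusion or contain no binder, and
    substitution leaves bound variables untouched by [bv_subst]. *)
Lemma rule1_bv N P S : rule1 N P S -> {subset bvq P <= bvq S}.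
Proof.
case=> *; move=> ?; rewrite /bvq /= ?bva_subst ?(bv_subst _ _).2 ?(mem_cat, inE) /=;
  repeat match goal with
  | |- context [?u \in ?s] => case: (u \in s)
  | |- context [?u == ?s] => case: (u == s)
  end;
  by rewrite ?orbT.
Qed.

Lemma rule2_bv P1 P2 S : rule2 P1 P2 S -> {subset bvq P1 ++ bvq P2 <= bvq S}.
Proof.
case=> *; move=> ?; rewrite /bvq /= ?bva_subst ?(bv_subst _ _).2 ?(mem_cat, inE) /=;
  repeat match goal with
  | |- context [?u \in ?s] => case: (u \in s)
  | |- context [?u == ?s] => case: (u == s)
  end;
  by rewrite ?orbT.
Qed.

(** * Adding a context to the rules *)

Definition addq S W : sequent := (S.1 ++ W.1, S.2 ++ W.2).

Lemma fvq_add S W x : (x \in fvq (addq S W)) = (x \in fvq S) || (x \in fvq W).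
Proof. by rewrite /fvq /= !map_cat !flatten_cat !mem_cat orbACA. Qed.

Lemma bvq_add S W x : (x \in bvq (addq S W)) = (x \in bvq S) || (x \in bvq W).
Proof. by rewrite /bvq /= !map_cat !flatten_cat !mem_cat orbACA. Qed.

Lemma labq_add S W x : (x \in labq (addq S W)) = (x \in labq S) || (x \in labq W).
Proof. by rewrite /labq /= !map_cat !flatten_cat !mem_cat orbACA. Qed.

(** [Q] stands for the variables of the premisses. An eigenvariable is among them and does not occur
    in [S], so the dichotomy places it outside [W]. *)
Lemma fresh_add (Q : seq V) z S W :
  (forall x, x \in Q -> x \in vq S \/ x \notin vq W) ->
  fresh z S -> z \in Q -> fresh z (addq S W).
Proof.
move=> H /andP[zf zb] /H[|]; rewrite mem_cat ?(negPf zf) ?(negPf zb) //.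
by rewrite /fresh fvq_add bvq_add (negPf zf) (negPf zb) negb_or.
Qed.

Lemma freshl_add (Q : seq L) u S W :
  (forall x, x \in Q -> x \in labq S \/ x \notin labq W) ->
  freshl u S -> u \in Q -> freshl u (addq S W).
Proof.
by move=> H uS /H[|]; rewrite /freshl ?(negPf uS) // labq_add (negPf uS).
Qed.

(** The dichotomies reach every eigenvariable and eigenlabel because each of them occurs visibly in
    the premiss, in an expression such as [Dom z w], [Den t z w] or [Rel w u]. *)
Lemma rule1_add N P S W :
  rule1 N P S -> (forall x, x \in vq P -> x \in vq S \/ x \notin vq W) ->
  (forall u, u \in labq P -> u \in labq S \/ u \notin labq W) ->
  rule1 N (addq P W) (addq S W).
Proof.
case=> *; rewrite /addq /=; solve [econstructor=> //;
  match goal with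
  | H : is_true (fresh ?z _), K : _ |- _ =>
      refine (fresh_add K H _)
  | H : is_true (freshl ?z _), K : _ |- _ =>
      refine (freshl_add K H _)
  end; by rewrite /vq /fvq /labq /= ?(mem_cat, inE) eqxx ?orbT].
Qed.

Lemma rule2_add P1 P2 S W :
  rule2 P1 P2 S ->
  (forall x, x \in vq P1 ++ vq P2 -> x \in vq S \/ x \notin vq W) ->
  rule2 (addq P1 W) (addq P2 W) (addq S W).
Proof.
case=> *; rewrite /addq /=; solve [econstructor=> //;
  match goal with
  | H : is_true (fresh ?z _), K : _ |- _ =>
      refine (fresh_add K H _)
  end; by rewrite /vq /fvq /labq /= ?(mem_cat, inE) eqxx ?orbT].
Qed.

Lemma initial_add S W : initial S -> initial (addq S W).
Proof. by case=> *; rewrite /addq /=; constructor. Qed.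

Lemma meq_add S S' W : meq S S' -> meq (addq S W) (addq S' W).
Proof. by case=> p1 p2; split; apply: Permutation.Permutation_app_tail. Qed.

(** Free variables may be shared between [S] and [W]. The bound variables of [W] avoid even the
    bound ones of [S]: in this form the condition passes to premisses whose variables lie in [S] or
    outside [W]. *)
Definition compatible S W : Prop :=
  [/\ pure W, forall x, x \in bvq W -> x \notin vq S
    & forall x, x \in fvq W -> x \notin bvq S].

Lemma pure_add S W : pure S -> compatible S W -> pure (addq S W).
Proof.
move=> pS [pW bf fb] x; rewrite fvq_add bvq_add.
apply/negP => /andP[/orP[] xf /orP[] xb].
- by have := pS x; rewrite xf xb.
- by have := bf _ xb; rewrite mem_cat xf.
- by have := fb _ xf; rewrite xb.
- by have := pW x; rewrite xf xb.
Qed.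

Lemma compatible_premiss S P W :
  compatible S W -> (forall x, x \in vq P -> x \in vq S \/ x \notin vq W) ->
  {subset bvq P <= bvq S} -> compatible P W.
Proof.
move=> [pW bf fb] H sub; split=> // x xW.
  apply/negP => /H[xS|]; first by have := bf _ xW; rewrite xS.
  by rewrite mem_cat xW orbT.
by apply/negP => /sub xS; have := fb _ xW; rewrite xS.
Qed.

(** * Height-preserving weakening *)

Hypotheses (Vinf : infinite_set [set: V]%classic)
  (Linf : infinite_set [set: L]%classic).

(* The renaming moves the eigenvariables and eigenlabels of the last rule, and
   every other name that is new in a premiss, away from [W], and leaves the
   conclusion unchanged. *)
Lemma derivation_add N n S W (d : derivation N S) :
  height d <= n -> compatible S W ->
  exists d' : derivation N (addq S W), height d' <= n.
Proof.
(* Induction on a height bound, since the renamed derivation of a premiss is not a subderivation of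
   [d]. *)
elim: n S d => [|n IH] S; first by case.
have comp S0 S1 : meq S0 S1 -> compatible S1 W -> compatible S0 W.
  by move=> m [pW bf fb]; split=> // x xW;
    rewrite ?(vq_meq m) ?(bvq_meq m); auto.
have away S0 Q Ql : exists f g,
    [/\ injective f, injective g, mapq f g S0 = S0,
        forall x, x \in map f Q -> x \in vq S0 \/ x \notin vq W
      & forall u, u \in map g Ql -> u \in labq S0 \/ u \notin labq W].
  have [f [fI f1 f2]] := injection_fixing Vinf (vq S0) (vq W) Q.
  have [g [gI g1 g2]] := injection_fixing Linf (labq S0) (labq W) Ql.
  exists f, g; split=> //; first exact: mapq_id_on.
    by move=> _ /mapP[x xQ ->]; apply: f2.
  by move=> _ /mapP[x xQ ->]; apply: g2.
case=> [S0 {}S i m p|P S0 {}S r m p d|P1 P2 S0 {}S r m p d1 d2] /= hd c.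
- by exists (Leaf N (initial_add W i) (meq_add W m) (pure_add p c)).
- have [f [g [fI gI S0E fP gP]]] := away S0 (vq P) (labq P).
  have := rule1_map fI gI r; rewrite S0E => r'.
  rewrite -(vq_map g fI) in fP; rewrite -(labq_map f) in gP.
  have [d' hd'] := derivation_map fI gI d.
  have [||d'' hd''] := IH _ d'; first by rewrite hd'.
    exact: compatible_premiss (comp _ _ m c) fP (rule1_bv r').
  by exists (Node1 (rule1_add r' fP gP) (meq_add W m) (pure_add p c) d'').
(* One renaming serves both premisses. No rule with two premisses has an eigenlabel, so no label has
   to be controlled. *)
- have [f [g [fI gI S0E fP _]]] := away S0 (vq P1 ++ vq P2) [::].
  have := rule2_map g fI r; rewrite S0E => r'.
  rewrite map_cat -!(vq_map g fI) in fP.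
  have [d1' hd1'] := derivation_map fI gI d1.
  have [d2' hd2'] := derivation_map fI gI d2.
  move: hd; rewrite ltnS geq_max -hd1' -hd2' => /andP[h1 h2].
  have [|d1'' hd1''] := IH _ d1' h1.
    apply: compatible_premiss (comp _ _ m c) _ _ => x xP.
      by apply: fP; rewrite mem_cat xP.
    by apply: (rule2_bv r'); rewrite mem_cat xP.
  have [|d2'' hd2''] := IH _ d2' h2.
    apply: compatible_premiss (comp _ _ m c) _ _ => x xP.
      by apply: fP; rewrite mem_cat xP orbT.
    by apply: (rule2_bv r'); rewrite mem_cat xP orbT.
  exists (Node2 (rule2_add r' fP) (meq_add W m) (pure_add p c) d1'' d2'').
  by rewrite /= ltnS geq_max hd1''.
Qed.

Lemma derivation_pure N S : derivation N S -> pure S.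
Proof. by case. Qed.

Lemma derivable_weakening N n (Γ Γ' : seq aexp) (Δ Δ' : seq sexp) :
  derivable N n (Γ, Δ) -> derivable N n (Γ' ++ Γ, Δ ++ Δ').
Proof.
case=> S [aS [d hd]]; pose W0 : sequent := (Γ', Δ').
have pS := derivation_pure d.
(* Keeping the free variables of [S] makes the image an alphabetic variant; its bound variables are
   to leave the free ones of [W0]. *)
have [f [fI f1 f2]] := injection_fixing Vinf (fvq S) (fvq W0) (bvq S).
have idI : injective (@id L) by [].
have [d1 hd1] := derivation_map fI idI d.
set S1 := mapq f id S in d1 hd1.
(* With nothing to fix, the dichotomy reduces to avoidance: every bound variable of [W0] moves off
   [fvq W0] and off all of [S1]. *)
have [h [hI _ h2]] :=
  injection_fixing Vinf [::] (fvq W0 ++ vq S1) (bvq W0).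
have hW0 x : x \in bvq W0 -> h x \notin fvq W0 ++ vq S1.
  by case/h2.
(* The added context is arbitrary and may have a variable both free and bound, so [mapq] would not
   do here; [S], in contrast, is pure. *)
pose W := renq h W0.
have c : compatible S1 W.
  split.
  - move=> x; apply/negP => /andP[/fvq_ren xf].
    rewrite bvq_ren => /mapP[u /hW0 + xE].
    by rewrite -xE mem_cat xf.
  - move=> x; rewrite bvq_ren => /mapP[u /hW0 + ->].
    by rewrite mem_cat negb_or => /andP[].
  - move=> x /fvq_ren xW; rewrite bvq_map; apply/negP => /mapP[u uS xE].
    case: (f2 _ uS) => [fuS|]; last by rewrite -xE xW.
    (* If [f u] were free in [S], it would be fixed, so [f (f u) = f u] and [f u = u]; then [u]
       would be both free and bound in the pure sequent [S]. *)
    have /fI fuE := f1 _ fuS.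
    by have := pS u; rewrite uS -{1}fuE fuS.
have [d2 hd2] : exists d2 : derivation N (addq S1 W), height d2 <= n.
  by apply: (derivation_add (d := d1)) => //; rewrite hd1.
(* [addq] appends on the right on both sides, whereas the new antecedent stands on the left in the
   goal. *)
have m : meq (addq S1 W) (W.1 ++ S1.1, S1.2 ++ W.2).
  by split=> //; apply: Permutation.Permutation_app_comm.
have pW : pure (W.1 ++ S1.1, S1.2 ++ W.2).
  move=> x; have := derivation_pure d2 x.
  rewrite fvq_add bvq_add /fvq /bvq /= !map_cat !flatten_cat !mem_cat.
  by do !case: (_ \in _).
have [d3 hd3] := derivation_meq d2 m pW.
exists (W.1 ++ S1.1, S1.2 ++ W.2); split; last by exists d3; rewrite hd3.
have [aS1 aS2] : alphaq (Γ, Δ) S1 by apply: alphaq_map.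
have [aW1 aW2] : alphaq W0 W.
  apply: alphaq_ren => // x y /hW0; rewrite mem_cat negb_or => /andP[hx _] yW.
  by apply: contraNneq hx => <-.
by split; apply: List.Forall2_app.
Qed.

End Renaming.

Theorem mainTheorem4
  (Sig : Type) (ar : Sig -> nat) (V L : eqType)
  (Vinf : infinite_set [set: V]%classic)
  (Linf : infinite_set [set: L]%classic)
  (N : nlrule -> Prop) :
  hp_admissible N (@LW Sig ar V L) /\ hp_admissible N (@RW Sig ar V L).
Proof.
split=> n _ _ [].
  move=> Γ Γ' Δ; rewrite -{2}[Δ]cats0; exact: derivable_weakening.
by move=> Γ Δ Δ'; exact: (@derivable_weakening _ _ _ _ Vinf Linf N n Γ [::]).
Qed.
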